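(* Let $\nu\in\mathcal{P}_\theta$ satisfy (MLSI--1) with some constant $c_\nu>0$, i.e. $$\mathrm{Ent}_\nu[F]\le c_\nu\,\nu\Big[\int_{\mathbb{R}^d}(D_xF)\,(D_x\log F)\,dx\Big]$$ for all bounded local functions $F>0$ on $\Omega$. Then $\mathscr{I}(\mu\,|\,\nu)>0$ for all $\mu\in\mathcal{P}_\theta\setminus\{\nu\}$.
   Context: $\Omega$ is the set of simple locally finite counting measures (point configurations) on $\mathbb{R}^d$, each identified with its support. $\mathcal{F}$ is the $\sigma$-algebra on $\Omega$ generated by the counting variables $N_\Lambda(\omega)=\#(\omega\cap\Lambda)$, for $\Lambda\Subset\mathbb{R}^d$, meaning $\Lambda\subseteq\mathbb{R}^d$ bounded and Borel. For $\Lambda\subseteq\mathbb{R}^d$, $\eta_\Lambda=\eta\cap\Lambda$. $\mathcal{F}_\Lambda$ is the sub-$\sigma$-algebra generated by $N_\Delta$, $\Delta\Subset\mathbb{R}^d$, $\Delta\subseteq\Lambda$, and $\mu_\Lambda$ is the restriction of a probability measure $\mu$ to $\mathcal{F}_\Lambda$. Translations act by $\theta_x\omega=\sum_i\delta_{x_i-x}$ for $\omega=\sum_i\delta_{x_i}$, and $\mathcal{P}_\theta$ is the set of probability measures on $(\Omega,\mathcal{F})$ invariant under all $\theta_x$, $x\in\mathbb{R}^d$. A measurable function $F:\Omega\to\mathbb{R}$ is local if there is $\Lambda\Subset\mathbb{R}^d$ with $F(\eta)=F(\eta_\Lambda)$ for all $\eta$. $\nu[F]$ denotes the expectation of $F$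 under $\nu$. Discrete gradient: $(D_xF)(\eta)=F(\eta+\delta_x)-F(\eta)$. Entropy: with $\Phi(x)=x\log x$ ($\Phi(0)=0$), $\mathrm{Ent}_\nu[F]=\nu[\Phi(F)]-\Phi(\nu[F])$. Relative entropy: $I(P\,|\,Q)=Q[\Phi(f)]$ if the density $f=dP/dQ$ exists, and $I(P\,|\,Q)=\infty$ otherwise. With $\Lambda_n=[-n,n]^d$ and $|\cdot|$ Lebesgue measure, the specific relative entropy is $\mathscr{I}(\mu\,|\,\nu)=\lim_{n\to\infty}\frac{1}{|\Lambda_n|}I(\mu_{\Lambda_n}\,|\,\nu_{\Lambda_n})$. *)

(* Defs.v *)
From HB Require Import structures.
From mathcomp Require Import all_boot all_order all_algebra finmap.
From mathcomp Require Import all_classical all_reals all_analysis.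
From mathcomp Require Import measurable_realfun.

Set Implicit Arguments.
Unset Strict Implicit.
Unset Printing Implicit Defensive.
Import Order.TTheory GRing.Theory Num.Theory.
Import numFieldNormedType.Exports.
Local Open Scope classical_set_scope.
Local Open Scope ring_scope.

(** * Borel sets and Lebesgue measure on R^d *)

Definition borel_mx_display : measure_display.
Proof. exact. Qed.

Section borel_mx.
Context (R : realType) (m n : nat).

Let borel0 : <<s @open 'M[R]_(m, n) >> set0.
Proof. exact: sigma_algebra0. Qed.

Let borelC A : <<s @open 'M[R]_(m, n) >> A -> <<s @open 'M[R]_(m, n) >> (~` A).
Proof. exact: sigma_algebraC. Qed.

Let borel_bigcup (F : (set 'M[R]_(m, n))^nat) :
  (forall i, <<s @open 'M[R]_(m, n) >> (F i)) ->
  <<s @open 'M[R]_(m, n) >> (\bigcup_i F i).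
Proof. exact: sigma_algebra_bigcup. Qed.

HB.instance Definition _ := @isMeasurable.Build borel_mx_display 'M[R]_(m, n)
  <<s @open 'M[R]_(m, n) >> borel0 borelC borel_bigcup.

End borel_mx.

Lemma measurable_coord (R : realType) (n : nat) (i : 'I_n) :
  measurable_fun [set: 'rV[R]_n] (fun x : 'rV[R]_n => x ord0 i).
Proof.
apply: (measurability _ (RGenOpens.measurableE R)).
move=> _ [_ [a [b ->]] <-]; rewrite setTI; apply: sub_sigma_algebra.
apply: open_comp; last exact: interval_open.
by move=> x _; exact: coord_continuous.
Qed.

Lemma measurable_rV (d : measure_display) (T : measurableType d) (R : realType)
    (n : nat) (f : T -> 'rV[R]_n) :
  (forall i, measurable_fun setT (fun t => f t ord0 i)) -> measurable_fun setT f.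
Proof.
move=> mf; apply: (measurability (@open 'rV[R]_n)) => // _ [U oU <-].
rewrite setTI.
pose c (p : 'rV[rat]_n * nat) : 'rV[R]_n := map_mx ratr p.1.
pose r (p : 'rV[rat]_n * nat) : R := p.2.+1%:R^-1.
pose P := [set p : 'rV[rat]_n * nat | ball (c p) (r p) `<=` U].
have mball p : measurable (f @^-1` ball (c p) (r p)).
  rewrite (_ : _ @^-1` _ = \bigcap_(i in [set: 'I_n])
      (fun t => f t ord0 i) @^-1` ball (c p ord0 i) (r p)).
    apply: fin_bigcap_measurable => // i _; rewrite -[X in measurable X]setTI.
    by apply: mf => //; apply: open_measurable; exact: ball_open.
  apply/seteqP; split => [t [_ h] i _|t h]; first exact: h.
  split; first by rewrite invr_gt0.
  by move=> i j; rewrite (ord1 i); exact: h.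
have -> : f @^-1` U = \bigcup_p (if p \in P then f @^-1` ball (c p) (r p) else set0).
  apply/seteqP; split => [t Uft|t [p _]]; last first.
    by case: ifPn => // /set_mem; exact.
  have [e /= e0 eU] := (nbhs_ballP _ _).1 (open_nbhs_nbhs (conj oU Uft)).
  have [k ke] : exists k, k.+1%:R^-1 < e / 2 :> R.
    have e20 : 0 < e / 2 by rewrite divr_gt0.
    by have [N _ /(_ N (leqnn _))] := near_infty_natSinv_lt (PosNum e20); exists N.
  have k0 : 0 < k.+1%:R^-1 :> R by rewrite invr_gt0.
  have hq i : exists q : rat, ball (ratr q : R) k.+1%:R^-1 (f t ord0 i).
    have /rat_in_itvoo[q] : f t ord0 i - k.+1%:R^-1 < f t ord0 i + k.+1%:R^-1.
      by rewrite ltrBlDr -addrA ltrDl addr_gt0.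
    by rewrite in_itv/= => hq; exists q; rewrite /ball/= ltr_distl.
  pose q := \row_i sval (cid (hq i)).
  have bq : ball (c (q, k)) (r (q, k)) (f t).
    split => // i j; rewrite (ord1 i) !mxE; exact: (svalP (cid (hq j))).
  exists (q, k) => //=; rewrite mem_set//= => y hy; apply: eU.
  rewrite (splitr e).
  apply: (@ball_triangle _ _ (c (q, k))).
    by apply/ball_sym; apply: le_ball bq; exact: ltW.
  by apply: le_ball hy; exact: ltW.
apply: countable_bigcupT_measurable => // p; by case: ifP.
Qed.

Definition cons_rV (R : realType) (n : nat)
    (p : measurableTypeR R * 'rV[R]_n) : 'rV[R]_n.+1 :=
  row_mx (p.1 : R)%:M p.2 : 'rV[R]_(1 + n).

Fixpoint lebesgue_rV (R : realType) (n : nat) : set 'rV[R]_n -> \bar R :=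
  match n with
  | 0 => \d_(0 : 'rV[R]_0)
  | n'.+1 =>
      pushforward (lebesgue_measure \x @lebesgue_rV R n')%E (@cons_rV R n')
  end.

Section lebesgue_rV.
Context (R : realType).

Lemma cons_rV0 n (p : measurableTypeR R * 'rV[R]_n) : cons_rV p ord0 ord0 = p.1.
Proof.
rewrite /cons_rV (_ : ord0 = lshift n (ord0 : 'I_1) :> 'I_(1 + n)); last first.
  exact: val_inj.
by rewrite (@row_mxEl _ 1 1 n) mxE eqxx mulr1n.
Qed.

Lemma cons_rV_lift n (p : measurableTypeR R * 'rV[R]_n) (i : 'I_n) :
  cons_rV p ord0 (lift ord0 i) = p.2 ord0 i.
Proof.
rewrite /cons_rV (_ : lift ord0 i = rshift 1 i :> 'I_(1 + n)); last first.
  exact: val_inj.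
by rewrite (@row_mxEr _ 1 1 n).
Qed.

Lemma measurable_cons_rV n : measurable_fun setT (@cons_rV R n).
Proof.
apply: measurable_rV => i; case: (unliftP ord0 i) => [j|] ->.
  under eq_fun do rewrite cons_rV_lift.
  apply: (measurableT_comp (measurable_coord j)); exact: measurable_snd.
by under eq_fun do rewrite cons_rV0; exact: measurable_fst.
Qed.

Lemma measurable_tail_rV n :
  measurable_fun setT (fun x : 'rV[R]_n.+1 => \row_i x ord0 (lift ord0 i)).
Proof.
apply: measurable_rV => i; under eq_fun do rewrite mxE.
exact: measurable_coord.
Qed.

Let uncons_rV n (x : 'rV[R]_n.+1) : measurableTypeR R * 'rV[R]_n :=
  (x ord0 ord0, \row_i x ord0 (lift ord0 i)).

Let cons_rVK n : cancel (@cons_rV R n) (@uncons_rV n).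
Proof.
move=> [a x]; rewrite /uncons_rV cons_rV0; congr (_, _).
by apply/rowP => i; rewrite mxE cons_rV_lift.
Qed.

Let measurable_uncons_rV n : measurable_fun setT (@uncons_rV n).
Proof.
apply/measurable_fun_pairP; split; first exact: measurable_coord.
exact: measurable_tail_rV.
Qed.

Let lebesgue_rV_structure n :
  exists m : {sigma_finite_measure set 'rV[R]_n -> \bar R},
    (m : set 'rV[R]_n -> \bar R) = @lebesgue_rV R n.
Proof.
elim: n => [|n [m /= <-]]; first by exists \d_(0 : 'rV[R]_0).
pose mu := pushforward (lebesgue_measure \x m)%E (@cons_rV R n).
have sfin : sigma_finite setT mu.
  pose leb : {sigma_finite_measure set (measurableTypeR R) -> \bar R} :=
    lebesgue_measure.
  have /sigma_finiteP[F [TF ndF Foo]] := sigma_finiteT leb.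
  have /sigma_finiteP[G [TG ndG Goo]] := sigma_finiteT m.
  exists (fun k => @uncons_rV n @^-1` (F k `*` G k)).
    apply/esym; rewrite -subTset => x _.
    have [i _ Fi] : (\bigcup_i F i) (x ord0 ord0) by rewrite -TF.
    have [j _ Gj] : (\bigcup_i G i) (\row_i x ord0 (lift ord0 i)) by rewrite -TG.
    exists (maxn i j) => //; split => /=.
      by move: Fi; exact/subsetPset/ndF/leq_maxl.
    by move: Gj; exact/subsetPset/ndG/leq_maxr.
  move=> k; have [mF Fk] := Foo k; have [mG Gk] := Goo k; split.
    rewrite -[X in measurable X]setTI; apply: measurable_uncons_rV => //.
    exact: measurableX.
  rewrite /mu /pushforward -comp_preimage (_ : _ \o _ = id); last first.
    by apply/funext => p; exact: cons_rVK.
  rewrite preimage_id product_measure1E//.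
  by rewrite lte_mul_pinfty// ge0_fin_numE//; exact: (measure_ge0 leb).
pose sfm := Measure_isSigmaFinite.Build _ _ _ mu sfin.
pose mu' : {sigma_finite_measure set 'rV[R]_n.+1 -> \bar R} := HB.pack mu (sfm (@measurable_cons_rV n)).
by exists (mu' (@measurable_cons_rV n)).
Qed.

Let lebesgue_rV0 n : @lebesgue_rV R n set0 = 0%E.
Proof. by have [m <-] := lebesgue_rV_structure n; exact: measure0. Qed.

Let lebesgue_rV_ge0 n A : (0 <= @lebesgue_rV R n A)%E.
Proof. by have [m <-] := lebesgue_rV_structure n; exact: measure_ge0. Qed.

Let lebesgue_rV_sigma_additive n : semi_sigma_additive (@lebesgue_rV R n).
Proof.
by have [m <-] := lebesgue_rV_structure n; exact: measure_semi_sigma_additive.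
Qed.

HB.instance Definition _ n := isMeasure.Build _ _ _ (@lebesgue_rV R n)
  (@lebesgue_rV0 n) (@lebesgue_rV_ge0 n) (@lebesgue_rV_sigma_additive n).

Let lebesgue_rV_sigma_finite n : sigma_finite setT (@lebesgue_rV R n).
Proof. by have [m <-] := lebesgue_rV_structure n; exact: sigma_finiteT. Qed.

HB.instance Definition _ n := Measure_isSigmaFinite.Build _ _ _
  (@lebesgue_rV R n) (@lebesgue_rV_sigma_finite n).

Lemma lebesgue_rV_box n (A : 'I_n -> set (measurableTypeR R)) :
  (forall i, measurable (A i)) ->
  @lebesgue_rV R n [set x | forall i, A i (x ord0 i)] =
    (\prod_i lebesgue_measure (A i))%E.
Proof.
elim: n A => [|n IH] A mA /=.
  rewrite big_ord0 diracE mem_set//; by case.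
rewrite /pushforward (_ : _ @^-1` _ = A ord0 `*`
    [set x : 'rV[R]_n | forall i, A (lift ord0 i) (x ord0 i)]); last first.
  apply/seteqP; split => [[a x] /= h|[a x] /= [h0 h] i].
    split; first by have := h ord0; rewrite cons_rV0.
    by move=> i; have := h (lift ord0 i); rewrite cons_rV_lift.
  by case: (unliftP ord0 i) => [j|] ->; rewrite ?cons_rV_lift ?cons_rV0.
rewrite product_measure1E//; first by rewrite big_ord_recl -IH.
rewrite (_ : mkset _ = \bigcap_(i in [set: 'I_n])
    (fun x : 'rV[R]_n => x ord0 i) @^-1` A (lift ord0 i)).
  apply: fin_bigcap_measurable => // i _; rewrite -[X in measurable X]setTI.
  exact: (@measurable_coord R n i measurableT _ (mA (lift ord0 i))).
by apply/seteqP; split => [x h i _|x h i]; exact: h.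
Qed.

End lebesgue_rV.

(** * Point configurations *)

Definition locally_finite (R : realType) (d : nat) (A : set 'rV[R]_d) :=
  forall B : set 'rV[R]_d, bounded_set B -> finite_set (A `&` B).

Record config (R : realType) (d : nat) := Config {
  config_points :> set 'rV[R]_d;
  config_pointsP : locally_finite config_points }.

Section config.
Context (R : realType) (d : nat).
Implicit Types (w : config R d) (L : set 'rV[R]_d) (x : 'rV[R]_d).

Lemma config_eqP w w' : config_points w = config_points w' -> w = w'.
Proof.
case: w w' => [A lA] [B lB] /= AB; case: _ / AB lB => lB.
by congr Config; exact: Prop_irrelevance.
Qed.

Let locally_finite0 : locally_finite (@set0 'rV[R]_d).
Proof. by move=> B _; rewrite set0I. Qed.

Let locally_finiteI w L : locally_finite (w `&` L).
Proof.
move=> B bB; apply: sub_finite_set (config_pointsP w bB).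
by move=> x [[wx _] Bx].
Qed.

Let locally_finiteU1 w x : locally_finite (w `|` [set x]).
Proof.
move=> B bB; apply: (@sub_finite_set _ _ ((w `&` B) `|` [set x])).
  by move=> y [[wy|yx] By]; [left|right].
by rewrite finite_setU; split; [exact: config_pointsP | exact: finite_set1].
Qed.

Let locally_finite_translate w x : locally_finite [set y - x | y in w].
Proof.
move=> B bB.
have bBx : bounded_set [set y + x | y in B].
  move: bB => [M [Mr MB]]; exists (M + `|x|); split; first exact: num_real.
  move=> N; rewrite -ltrBrDr => MN _ [y By <-] /=.
  by rewrite (le_trans (ler_normD _ _))// -lerBrDr; exact: (MB _ MN).
have := finite_image (fun y => y - x) (config_pointsP w bBx).
apply: sub_finite_set => _ [[y wy <-] Byx].
exists y => //; split => //; exists (y - x) => //; exact: subrK.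
Qed.

Definition config0 : config R d := Config locally_finite0.

Definition config_restrict w L : config R d := Config (@locally_finiteI w L).

(* When [x] already belongs to [w] the result is [w] itself, and not a
   configuration with a double point, which would lie outside the space of
   simple configurations; for fixed [w] such [x] form a countable set, hence a
   Lebesgue-null set if [0 < d]. *)
Definition config_add w x : config R d := Config (@locally_finiteU1 w x).

Definition translate x w : config R d := Config (@locally_finite_translate w x).

(* Finite, hence a meaningful cardinal, only for bounded [L]. *)
Definition point_count L w : nat := #|` fset_set (w `&` L)|.

Definition counting_events L : set (set (config R d)) :=
  [set E | exists (D : set 'rV[R]_d) (k : nat),
    [/\ measurable D, bounded_set D, D `<=` L & E = [set w | point_count D w = k]]].

End config.

HB.instance Definition _ (R : realType) (d : nat) := gen_eqMixin (config R d).
HB.instance Definition _ (R : realType) (d : nat) :=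
  gen_choiceMixin (config R d).
HB.instance Definition _ (R : realType) (d : nat) :=
  isPointed.Build (config R d) (@config0 R d).

(* All configurations (not only those contained in [L]), with the sigma-algebra
   generated by the counting variables of the bounded Borel subsets of [L]. *)
Definition local_config_space (R : realType) (d : nat) (L : set 'rV[R]_d) :=
  g_sigma_algebraType (counting_events L).

Notation config_space R d := (@local_config_space R d setT).

HB.instance Definition _ (R : realType) (d : nat) (L : set 'rV[R]_d) :=
  Measurable.on (@local_config_space R d L).

Definition local_id (R : realType) (d : nat) (L : set 'rV[R]_d)
  (w : config_space R d) : local_config_space L := w.

Lemma measurable_local_id (R : realType) (d : nat) (L : set 'rV[R]_d) :
  measurable_fun setT (@local_id R d L).
Proof.
apply: (@measurability _ _ _ _ setT (@local_id R d L) (counting_events L)) => // _ [_ [D [k [mD bD DL ->]]] <-].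
by rewrite setTI; apply: sub_sigma_algebra; exists D, k; split.
Qed.

HB.instance Definition _ (R : realType) (d : nat) (L : set 'rV[R]_d) :=
  isMeasurableFun.Build _ _ _ _ (@local_id R d L) (@measurable_local_id R d L).

(* [A |-> mu A] for [A] in the sub-sigma-algebra attached to [L]. *)
Definition restrict_measure (R : realType) (d : nat)
    (mu : probability (config_space R d) R) (L : set 'rV[R]_d) :
    probability (local_config_space L) R :=
  distribution mu (@local_id R d L).

Definition translation_invariant (R : realType) (d : nat)
    (mu : probability (config_space R d) R) :=
  forall (x : 'rV[R]_d) (A : set (config_space R d)), measurable A ->
    pushforward mu (translate x : config_space R d -> config_space R d) A = mu A.

(* Library measures are set functions on all subsets: two measures are the same
   measure when they agree on measurable sets. *)
Definition same_measure (d : measure_display) (T : measurableType d)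
    (R : realType) (P Q : probability T R) :=
  forall A : set T, measurable A -> P A = Q A.

(** * Entropy *)

(* [ln 0 = 0], and in any case [Phi 0 = 0]. *)
Definition Phi (R : realType) (x : R) : R := x * ln x.

Definition Ent (d : measure_display) (T : measurableType d) (R : realType)
    (P : probability T R) (F : T -> R) : \bar R :=
  ('E_P[fun t => Phi (F t)] - (Phi (fine 'E_P[F]))%:E)%E.

Definition is_density (d : measure_display) (T : measurableType d)
    (R : realType) (P Q : probability T R) (f : T -> R) :=
  [/\ measurable_fun setT f, forall t, 0 <= f t &
      forall A, measurable A -> P A = (\int[Q]_(t in A) (f t)%:E)%E].

Definition relative_entropy (d : measure_display) (T : measurableType d)
    (R : realType) (P Q : probability T R) : \bar R :=
  match pselect (exists f, is_density P Q f) with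
  | left ex => 'E_Q[fun t => Phi (sval (cid ex) t)]%E
  | right _ => +oo%E
  end.

Definition centered_box (R : realType) (d n : nat) : set 'rV[R]_d :=
  [set x | forall i, - n%:R <= x ord0 i <= n%:R].

Definition relative_entropy_density (R : realType) (d : nat)
    (mu nu : probability (config_space R d) R) (n : nat) : \bar R :=
  ((fine (lebesgue_rV (@centered_box R d n)))^-1%:E *
   relative_entropy (restrict_measure mu (@centered_box R d n))
                    (restrict_measure nu (@centered_box R d n)))%E.

(* The limit of [relative_entropy_density mu nu] need not exist for arbitrary
   stationary [mu] and [nu]; the lower limit always does, and it is the limit
   whenever there is one, see [specific_relative_entropy_lim]. *)
Definition specific_relative_entropy (R : realType) (d : nat)
    (mu nu : probability (config_space R d) R) : \bar R :=
  limn_einf (relative_entropy_density mu nu).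

Lemma specific_relative_entropy_lim (R : realType) (d : nat)
    (mu nu : probability (config_space R d) R) (l : \bar R) :
  relative_entropy_density mu nu @ \oo --> l ->
  specific_relative_entropy mu nu = l.
Proof. by move=> /cvg_limn_einf_sup[]. Qed.

(** * The modified logarithmic Sobolev inequality *)

Definition local_function (R : realType) (d : nat) (F : config_space R d -> R) :=
  exists L : set 'rV[R]_d, [/\ measurable L, bounded_set L &
    forall w : config_space R d, F w = F (config_restrict w L)].

Definition gradient (R : realType) (d : nat) (F : config_space R d -> R)
    (x : 'rV[R]_d) (w : config_space R d) : R :=
  F (config_add w x) - F w.

Definition MLSI1 (R : realType) (d : nat) (nu : probability (config_space R d) R)
    (c : R) :=
  forall F : config_space R d -> R,
    measurable_fun setT F -> local_function F -> bounded_fun F -> (forall w, 0 < F w) ->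
    (Ent nu F <= c%:E * \int[nu]_w \int[@lebesgue_rV R d]_x
       (gradient F x w * gradient (fun w' => ln (F w')) x w)%:E)%E.

(* Main.v *)
Require Import Defs.
From mathcomp Require Import all_boot all_order all_algebra finmap.
From mathcomp Require Import all_classical all_reals all_analysis.
From mathcomp Require Import measurable_realfun ring lra zify.

Set Implicit Arguments.
Unset Strict Implicit.
Unset Printing Implicit Defensive.
Import Order.TTheory GRing.Theory Num.Theory.
Import numFieldNormedType.Exports.
Local Open Scope classical_set_scope.
Local Open Scope ring_scope.

(** The modified logarithmic Sobolev inequality yields, through the Herbst
    argument, a Laplace transform estimate whose exponent is of the order of the
    volume; by duality this forces the relative entropy in a large box to be of
    the order of the volume as well.

    Two different measures already differ on an event [A] that depends on the
    points in some box [-m, m]^d only, because these events form a pi-system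
    that generates the whole sigma-algebra ([separating_local_event]). After
    passing to the complement, [delta := mu A - nu A > 0]. In the box
    [L := [-n, n]^d] one can place a number [N] proportional to [n ^ d] of
    disjoint translates of [-m, m]^d; let [G] be the number of corresponding
    translates of [A] that occur. By stationarity the means of [G] under [mu]
    and [nu] are [N * mu A] and [N * nu A].

    Adding a point outside [L] does not change [G], and adding a point inside
    [L] affects at most one of the disjoint boxes, so [D_x G] vanishes off [L]
    and lies between -1 and 1. The inequality applied to [F := expR (l * G)] with
    [0 < l <= 1] therefore gives ([MLSI1_exp_bound])
      [Ent_nu F <= c * e * |L| * l ^ 2 * nu F],
    which is a differential inequality for [l |-> ln (nu (expR (l * G)))]. Its
    integrated form ([Herbst_nat_valued]) is
      [ln (nu (expR (t * G))) <= t * N * nu A + c * e * |L| * t ^ 2],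
    and the variational lower bound for the entropy ([Donsker_Varadhan]) turns
    it into ([relative_entropy_packing])
      [I (mu_L | nu_L) >= t * N * delta - c * e * |L| * t ^ 2].
    Since [N >= kappa * |L|] for a constant [kappa > 0] that does not depend on
    [n], a small fixed [t] makes the right-hand side at least a positive
    multiple of [|L|], uniformly in [n].

    As [G] takes finitely many values, every expectation above is a finite sum
    over these values: the Laplace transform can be differentiated term by term,
    and the integral of a function of [G] against a density reduces to the
    probabilities of the level sets of [G]. *)

(** * The Herbst argument *)

(** The hypothesis says that [l |-> K l / l] has derivative at most [C]: this
    function minus [C * l] is nonincreasing, so its value at [t] is bounded by
    its limit [dK 0] at 0. *)
Lemma Herbst_argument (R : realType) (K dK : R -> R) (C t : R) : 0 < t ->
  (forall l : R, is_derive l (1 : R) K (dK l)) -> K 0 = 0 ->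
  (forall l : R, 0 < l -> l < t -> l * dK l - K l <= C * l ^+ 2) ->
  K t <= t * dK 0 + C * t ^+ 2.
Proof.
move=> t0 derK K0 entK.
pose psi (l : R) : R := K l * l^-1 - C * l.
pose dpsi (l : R) : R := (l * dK l - K l) * l ^- 2 - C.
have derpsi (l : R) : 0 < l -> is_derive l (1 : R) psi (dpsi l).
  move=> l0; have ln0 : l != 0 by rewrite gt_eqF.
  have dl : is_derive l (1 : R) (fun y : R => y^-1) (- l ^- 2 *: (1 : R)).
    exact: (@is_deriveV _ id).
  have dKl := derK l.
  apply: (@is_derive_eq _ _ _ _ _ _ _ _ (is_deriveB (is_deriveM dKl dl)
    (is_deriveZ C (is_derive_id l (1 : R))))).
  rewrite /dpsi /GRing.scale /=; field; exact: ln0.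
have cpsi : {within `]0, t], continuous psi}.
  apply: derivable_within_continuous => x; rewrite in_itv /= => /andP[x0 _].
  by have [] := derpsi x x0.
have psi_le s : 0 < s -> s <= t -> psi t <= psi s.
  move=> s0 st; apply: (ler0_derive1_le_oc _ _ cpsi) => //.
  - by move=> x; rewrite in_itv /= => /andP[x0 _]; have [] := derpsi x x0.
  - move=> x; rewrite in_itv /= => /andP[x0 xt].
    rewrite derive1E; have [_ ->] := derpsi x x0.
    rewrite subr_le0 ler_pdivrMr ?exprn_gt0//; exact: entK.
  - by rewrite in_itv /= t0 lexx.
  - by rewrite in_itv /= s0.
have cvK : (fun h => K h / h) @ 0^'+ --> dK 0.
  have [dK0 <-] := derK 0; apply: cvg_dnbhs_at_right.
  have quotE : (fun h : R => h^-1 *: ((K \o shift 0) (h *: (1 : R)) - K 0)) =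
      (fun h => K h / h).
    by apply/funext => h /=; rewrite addr0 K0 subr0 /GRing.scale /= mulr1 mulrC.
  rewrite /derive quotE; rewrite /derivable quotE in dK0; exact: dK0.
have cvpsi : psi @ 0^'+ --> dK 0.
  have -> : dK 0 = dK 0 - C * 0 by rewrite mulr0 subr0.
  by apply: cvgB => //; apply: cvg_at_right_filter; exact: mulrl_continuous.
have : psi t <= dK 0.
  rewrite -(cvg_lim _ cvpsi)//; apply: limr_ge; first by apply/cvg_ex; exists (dK 0).
  by near=> s; apply: psi_le; near: s; [exact: nbhs_right_gt | exact: nbhs_right_le].
rewrite /psi lerBlDr ler_pdivrMr//; congr (_ <= _); ring.
Unshelve. all: by end_near. Qed.

(** * Expectations of functions of a bounded integer variable *)

Section nat_valued.
Context (dd : measure_display) (T : measurableType dd) (R : realType).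
Variables (P : probability T R) (G : T -> nat) (N : nat).
Hypothesis mG : forall j, measurable [set w | G w = j].
Hypothesis GN : forall w, (G w <= N)%N.

Lemma nat_valued_decomp (phi : nat -> R) (u : T -> R) w :
  ((phi (G w) * u w)%:E =
   \sum_(j < N.+1) (phi j)%:E * ((fun w => (u w)%:E) \_ [set w | G w = j]) w)%E.
Proof.
have ltG : (G w < N.+1)%N by rewrite ltnS.
rewrite (bigD1 (Ordinal ltG))//= patchE ifT ?inE// big1 ?adde0 ?EFinM//.
move=> j jG; rewrite patchE ifF ?mule0//; apply: memNset => /= Gj.
by move/eqP: jG; apply; apply: val_inj.
Qed.

(** The weight [u] is 1 for expectations under [P], and the density of another
    measure for a change of measure. *)
Lemma integral_nat_valued (phi : nat -> R) (u : T -> R) :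
  P.-integrable setT (fun w => (u w)%:E) ->
  P.-integrable setT (fun w => (phi (G w) * u w)%:E) /\
  (\int[P]_w (phi (G w) * u w)%:E =
    \sum_(j < N.+1) (phi j)%:E * \int[P]_(w in [set w | G w = j]) (u w)%:E)%E.
Proof.
move=> iu.
have iu1 j : P.-integrable setT ((fun w => (u w)%:E) \_ [set w | G w = j]).
  by apply/(integrable_mkcond _ (mG j)); exact: (integrableS measurableT _ _ iu).
have iuj j : P.-integrable setT
    (fun w => (phi j)%:E * ((fun w => (u w)%:E) \_ [set w | G w = j]) w)%E.
  by apply: integrableZl => //; exact: iu1.
have -> : (fun w => (phi (G w) * u w)%:E) = (fun w => \sum_(j < N.+1)
    (phi j)%:E * ((fun w => (u w)%:E) \_ [set w | G w = j]) w)%E.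
  by apply/funext => w; exact: nat_valued_decomp.
split; first by apply: (integrable_sum measurableT) => j _; exact: iuj.
rewrite integral_sum//; apply: eq_bigr => j _.
rewrite (integralZl measurableT (iu1 j)).
by rewrite -integral_mkcond.
Qed.

Let p (j : nat) : R := fine (P [set w | G w = j]).

Let PE j : P [set w | G w = j] = (p j)%:E.
Proof. by rewrite fineK// fin_num_measure. Qed.

Lemma integrable_nat_valued (phi : nat -> R) :
  P.-integrable setT (fun w => (phi (G w))%:E).
Proof.
have [+ _] := integral_nat_valued phi (u:=fun=> 1)
  (finite_measure_integrable_cst P 1 measurableT).
by under eq_fun do rewrite mulr1.
Qed.

Lemma expectation_nat_valued (phi : nat -> R) :
  ('E_P[fun w => phi (G w)] = (\sum_(j < N.+1) phi j * p j)%:E)%E.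
Proof.
rewrite unlock.
have [_ +] := integral_nat_valued phi (u:=fun=> 1)
  (finite_measure_integrable_cst P 1 measurableT).
under eq_integral do rewrite mulr1.
move=> ->; rewrite -sumEFin; apply: eq_bigr => j _.
rewrite integral_cst// mul1e EFinM; congr (_ * _)%E; exact: PE.
Qed.

Lemma sum_nat_valued_law : \sum_(j < N.+1) p j = 1.
Proof.
have := expectation_nat_valued (fun=> 1).
rewrite expectation_cst => -[sum_p].
by rewrite [RHS]sum_p; apply: eq_bigr => j _; rewrite mul1r.
Qed.

End nat_valued.

(** * Laplace transform and entropy duality *)

Section laplace.
Context (dd : measure_display) (T : measurableType dd) (R : realType).
Variables (P : probability T R) (G : T -> nat) (N : nat).
Hypothesis mG : forall j, measurable [set w | G w = j].
Hypothesis GN : forall w, (G w <= N)%N.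

Let p (j : nat) : R := fine (P [set w | G w = j]).
Let Z (l : R) : R := \sum_(j < N.+1) expR (l * j%:R) * p j.

Let EZ l : 'E_P[fun w => expR (l * (G w)%:R)]%E = (Z l)%:E.
Proof. exact: (expectation_nat_valued _ mG GN (fun j => expR (l * j%:R))). Qed.

Let p_ge0 j : 0 <= p j.
Proof. by rewrite fine_ge0. Qed.

(* All weights with [j <= N] are at least [expR (- (`|l| * N))], whatever the
   sign of [l]. *)
Let Z_gt0 l : 0 < Z l.
Proof.
apply: (@lt_le_trans _ _ (\sum_(j < N.+1) expR (- (`|l| * N%:R)) * p j)).
  by rewrite -mulr_sumr sum_nat_valued_law// mulr1 expR_gt0.
apply: ler_sum => j _; apply: ler_wpM2r => //; rewrite ler_expR.
rewrite lerNl (le_trans (ler_norm _))// normrN normrM (ger0_norm (ler0n _ j)).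
by apply: ler_wpM2l => //; rewrite ler_nat -ltnS.
Qed.

Lemma laplace_gt0 l : 0 < fine 'E_P[fun w => expR (l * (G w)%:R)]%E.
Proof. by rewrite EZ/=. Qed.

(** With [Z] the Laplace transform of [G], the entropy of [expR (l * G)] is
    [l * Z' l - Z l * ln (Z l)], so that after division by [Z l] the hypothesis
    is the one of [Herbst_argument] for [K := ln o Z], and [K' 0] is the mean of
    [G]. *)
Lemma Herbst_nat_valued (C t : R) : 0 < t ->
  (forall l : R, 0 < l -> l < t ->
    (Ent P (fun w => expR (l * (G w)%:R)) <=
     (C * l ^+ 2)%:E * 'E_P[fun w => expR (l * (G w)%:R)])%E) ->
  ln (fine 'E_P[fun w => expR (t * (G w)%:R)]%E) <=
  t * fine 'E_P[fun w => (G w)%:R]%E + C * t ^+ 2.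
Proof.
move=> t0 entP.
pose dZ l := \sum_(j < N.+1) j%:R * expR (l * j%:R) * p j.
have derZ (l : R) : is_derive l (1 : R) Z (dZ l).
  have -> : Z = \sum_(j < N.+1) (fun l : R => expR (l * j%:R) * p j).
    by apply/funext => x; rewrite fct_sumE.
  apply: is_derive_sum => j.
  have dlj : is_derive l (1 : R) (fun l : R => l * j%:R) (j%:R).
    have -> : (fun l : R => l * j%:R) = (j%:R : R) *: id.
      by apply/funext => x /=; rewrite mulrC.
    apply: is_derive_eq (is_deriveZ _ (is_derive_id l (1 : R))) _.
    by rewrite /GRing.scale /= mulr1.
  have -> : (fun l : R => expR (l * j%:R) * p j) =
      p j *: (expR \o (fun l : R => l * j%:R)).
    by apply/funext => x /=; rewrite mulrC.
  apply: is_derive_eq (is_deriveZ _ (is_derive1_comp (is_derive_expR _) dlj)) _.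
  by rewrite /GRing.scale /=; ring.
have derK (l : R) : is_derive l (1 : R) (@ln R \o Z) ((Z l)^-1 * dZ l).
  by apply: is_derive1_comp => //; exact: is_derive1_ln.
have Z0 : Z 0 = 1.
  rewrite -(sum_nat_valued_law P mG GN); apply: eq_bigr => j _.
  by rewrite mul0r expR0 mul1r.
have /(Herbst_argument t0 derK) H :
    forall l : R, 0 < l -> l < t -> l * ((Z l)^-1 * dZ l) - (@ln R \o Z) l <= C * l ^+ 2.
  move=> l l0 lt; have := entP l l0 lt; rewrite /Ent EZ /=.
  have -> : (fun w => Phi (expR (l * (G w)%:R))) =
      (fun w => expR (l * (G w)%:R) * (l * (G w)%:R)).
    by apply/funext => w; rewrite /Phi expRK.
  rewrite (expectation_nat_valued P mG GN (fun j => expR (l * j%:R) * (l * j%:R))).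
  rewrite -EFinB -EFinM lee_fin.
  have -> : \sum_(j < N.+1) expR (l * j%:R) * (l * j%:R) * p j = l * dZ l.
    by rewrite mulr_sumr; apply: eq_bigr => j _; ring.
  rewrite /Phi => H.
  rewrite -(ler_pM2r (Z_gt0 l)) mulrBl mulrA mulrAC mulfVK ?gt_eqF//.
  by rewrite [ln _ * _]mulrC.
rewrite EZ/=; apply: le_trans (H _) _; first by rewrite /= Z0 ln1.
rewrite lerD2r Z0 invr1 mul1r.
rewrite (expectation_nat_valued _ mG GN (fun j => j%:R))/=.
rewrite le_eqVlt; apply/orP; left; apply/eqP; congr (_ * _).
by apply: eq_bigr => j _; rewrite mul0r expR0 mulr1.
Qed.

End laplace.

(** The functions [Phi] minus identity and [expR] are convex conjugates of each
    other; the inequality is [1 + u <= expR u] at [u := y - ln x]. *)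
Lemma Young_entropy (R : realType) (x y : R) : 0 <= x -> x * (y + 1) - expR y <= Phi x.
Proof.
rewrite le_eqVlt => /predU1P[<-|x0]; first by rewrite /Phi !mul0r sub0r oppr_le0 expR_ge0.
have -> : expR y = x * expR (y - ln x).
  by rewrite expRD expRN lnK ?posrE// mulrCA mulfV ?gt_eqF// mulr1.
rewrite -mulrBr /Phi ler_pM2l//.
have := expR_ge1Dx (y - ln x); lra.
Qed.

(** Here [g] need not be integrable. This matters for [Phi] of a density, whose
    expectation may be infinite. *)
Lemma le_integral_of_integrable_minorant (dd : measure_display) (T : measurableType dd)
    (R : realType) (P : probability T R) (f g : T -> \bar R) :
  P.-integrable setT f -> measurable_fun setT g ->
  (forall w, f w <= g w)%E -> (\int[P]_w f w <= \int[P]_w g w)%E.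
Proof.
move=> /integrableP[mf _] mg fg; rewrite integralE [leRHS]integralE leeB//.
- apply: ge0_le_integral => //.
  + exact: measurable_funepos.
  + exact: measurable_funepos.
  + by move=> w /mem_set; apply: funepos_le => x _; exact: fg.
- apply: ge0_le_integral => //.
  + exact: measurable_funeneg.
  + exact: measurable_funeneg.
  + by move=> w /mem_set; apply: funeneg_le => x _; exact: fg.
Qed.

(** Integrate [Young_entropy] at [x := f w], the density, and
    [y := t * G w - ln (Q (expR (t * G)))]: the normalisation makes the integral
    of [expR y] equal to 1, which compensates the total mass of [f]. *)
Lemma Donsker_Varadhan (dd : measure_display) (T : measurableType dd)
    (R : realType) (P Q : probability T R) (G : T -> nat) (N : nat) (t : R) :
  (forall j, measurable [set w | G w = j]) -> (forall w, (G w <= N)%N) ->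
  ((t * fine 'E_P[fun w => (G w)%:R] -
    ln (fine 'E_Q[fun w => expR (t * (G w)%:R)]))%:E <= relative_entropy P Q)%E.
Proof.
move=> mG GN; rewrite /relative_entropy.
case: pselect => [ex|_]; last exact: leey.
case: (cid ex) => f [mf f0 Pf] /=.
set z := ln _.
have fint : Q.-integrable setT (fun w => (f w)%:E).
  apply/integrableP; split; first exact/measurable_EFinP.
  under eq_integral do rewrite gee0_abs ?lee_fin//.
  by rewrite -Pf// probability_setT ltry.
pose a (j : nat) : R := t * j%:R - z.
have [ia Ia] := integral_nat_valued mG GN (fun j => a j + 1) fint.
have ib := integrable_nat_valued Q mG GN (fun j => expR (a j)).
have Ib := expectation_nat_valued Q mG GN (fun j => expR (a j)).
have EP := expectation_nat_valued P mG GN (fun j => j%:R).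
rewrite unlock in Ib EP; rewrite unlock.
apply: (@le_trans _ _ (\int[Q]_w (((a (G w) + 1) * f w)%:E - (expR (a (G w)))%:E))%E); last first.
  apply: le_integral_of_integrable_minorant.
  - exact: integrableB.
  - apply/measurable_EFinP; apply: measurable_funM => //.
    by apply: measurableT_comp => //; exact: measurable_ln.
  - by move=> w; rewrite -EFinB lee_fin mulrC; exact: Young_entropy.
rewrite integralB//.
pose p j := fine (P [set w | G w = j]).
pose q j := fine (Q [set w | G w = j]).
have Iap : (\sum_(j < N.+1) ((a j + 1)%:E *
    \int[Q]_(w in [set w | G w = j]) (f w)%:E) =
    (\sum_(j < N.+1) (a j + 1) * p j)%:E)%E.
  rewrite -sumEFin; apply: eq_bigr => j _; rewrite EFinM; congr (_ * _)%E.
  by rewrite -Pf// fineK// fin_num_measure.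
rewrite Ia Iap Ib EP -EFinB lee_fin /=.
have -> : \sum_(j < N.+1) (a j + 1) * p j =
    t * \sum_(j < N.+1) j%:R * p j + (1 - z) * \sum_(j < N.+1) p j.
  by rewrite !mulr_sumr -big_split; apply: eq_bigr => j _ /=; rewrite /a; ring.
have -> : \sum_(j < N.+1) expR (a j) * q j = 1.
  have -> : 1 = expR (- z) * \sum_(j < N.+1) expR (t * j%:R) * q j :> R.
    have := laplace_gt0 Q mG GN t.
    rewrite /z (expectation_nat_valued Q mG GN (fun j => expR (t * j%:R))) /= => Z0.
    by rewrite expRN lnK ?posrE// mulVf ?gt_eqF.
  by rewrite mulr_sumr; apply: eq_bigr => j _; rewrite /a expRD; ring.
rewrite /p sum_nat_valued_law//; lra.
Qed.

(** * Local events *)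

Section local_events.
Context (R : realType) (d : nat).
Implicit Types (w : config R d) (L D : set 'rV[R]_d) (x : 'rV[R]_d)
  (A : set (config R d)).

Lemma config_restrict_add w x L : ~ L x ->
  config_restrict (config_add w x) L = config_restrict w L.
Proof.
move=> Lx; apply: config_eqP; apply/seteqP; split=> y /=; last first.
  by move=> [? ?]; split=> //; left.
by move=> [[wy|->]].
Qed.

Lemma point_count_restrict w L D : D `<=` L ->
  point_count D (config_restrict w L) = point_count D w.
Proof.
move=> DL; rewrite /point_count /=; congr (#|` fset_set _ |).
by rewrite -setIA; congr (_ `&` _); apply: setIidr.
Qed.

Lemma bounded_shift D x : bounded_set D -> bounded_set [set y | D (y - x)].
Proof.
move=> [M [_ MD]]; exists (M + `|x|); split; first exact: num_real.
move=> N; rewrite -ltrBrDr => MN y Dy /=; rewrite -(subrK x y).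
by rewrite (le_trans (ler_normD _ _))// -lerBrDr; exact: (MD _ MN).
Qed.

Lemma measurable_shift D x : measurable D -> measurable [set y | D (y - x)].
Proof.
move=> mD; rewrite -[X in measurable X]setTI.
have : measurable_fun setT (fun y : 'rV[R]_d => y - x).
  apply: measurable_rV => i; under eq_fun do rewrite !mxE.
  by apply: measurable_funD => //; exact: measurable_coord.
exact.
Qed.

Lemma point_count_translate w x D : bounded_set D ->
  point_count D (translate x w) = point_count [set y | D (y - x)] w.
Proof.
move=> bD; rewrite /point_count.
have inj_subx : injective (fun y : 'rV[R]_d => y - x) by exact: subIr.
have imE : translate x w `&` D =
    (fun y => y - x) @` (w `&` [set y | D (y - x)]).
  apply/seteqP; split=> [_ [[y wy <-] Dy]|_ [y [wy Dy] <-]]; first by exists y.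
  by split=> //; exists y.
have fin := config_pointsP w (@bounded_shift D x bD).
by rewrite imE fset_set_image// card_imfset.
Qed.

(** The events with this invariance form a sigma-algebra that contains the
    counting events of [L]. *)
Lemma local_event_restrict L A w : <<s counting_events L >> A ->
  A (config_restrict w L) <-> A w.
Proof.
move=> sA; pose E := [set B : set (config R d) |
  forall w, B (config_restrict w L) <-> B w].
suff : <<s counting_events L >> `<=` E by move=> /(_ A sA).
apply: smallest_sub.
  split=> [//|B EB v|B EB v]; first by split=> -[_ nB]; split=> // /EB.
  by split=> -[k _ Bk]; exists k => //; apply/EB.
by move=> _ [D [k [mD bD DL ->]]] v /=; rewrite point_count_restrict.
Qed.

Lemma local_event_add L A w x : <<s counting_events L >> A -> ~ L x ->
  A (config_add w x) <-> A w.
Proof.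
move=> sA Lx; rewrite -(local_event_restrict (config_add w x) sA).
by rewrite config_restrict_add//; exact: local_event_restrict.
Qed.

Lemma sub_local_event L L' A : L `<=` L' ->
  <<s counting_events L >> A -> <<s counting_events L' >> A.
Proof.
move=> LL'; apply: sub_smallest2r; first exact: smallest_sigma_algebra.
move=> _ [D [k [mD bD DL ->]]].
by exists D, k; split=> //; exact: subset_trans LL'.
Qed.

Lemma local_event_translate L L' A x : (forall y, L (y - x) -> L' y) ->
  <<s counting_events L >> A ->
  <<s counting_events L' >> (translate x @^-1` A).
Proof.
move=> LL' sA.
have mtr : measurable_fun setT
    (translate x : local_config_space L' -> local_config_space L).
  apply: (@measurability _ _ (local_config_space L') (local_config_space L)
    setT (translate x) (counting_events L)) => // _ [_ [D [k [mD bD DL ->]]] <-].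
  rewrite setTI; apply: sub_sigma_algebra.
  exists [set y | D (y - x)], k; split.
  - exact: measurable_shift.
  - exact: bounded_shift.
  - by move=> y Dy; apply: LL'; exact: DL.
  - by apply/seteqP; split=> v /=; rewrite point_count_translate.
by rewrite -[X in <<s _ >> X]setTI; exact: mtr.
Qed.

End local_events.

(** * Number of occurring events and its discrete gradient *)

Definition event_count (T : Type) (I : finType) (A : I -> set T) (w : T) : nat :=
  (\sum_i (w \in A i))%N.

Lemma event_count_le (T : Type) (I : finType) (A : I -> set T) (w : T) :
  (event_count A w <= #|I|)%N.
Proof. by rewrite -sum1_card; apply: leq_sum => i _; case: (w \in A i). Qed.

Section event_count_measurable.
Context (dd : measure_display) (T : measurableType dd) (R : realType) (I : finType).
Variables (A : I -> set T).
Hypothesis mA : forall i, measurable (A i).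

Lemma event_countE (w : T) : (event_count A w)%:R = \sum_i \1_(A i) w :> R.
Proof. by rewrite natr_sum. Qed.

Lemma measurable_event_count (j : nat) : measurable [set w | event_count A w = j].
Proof.
have mf : measurable_fun setT (fun w : T => \sum_i \1_(A i) w : R).
  by apply: measurable_sum => i; exact: measurable_indic.
have := mf measurableT [set j%:R] (measurable_set1 _).
rewrite setTI; congr (measurable _); apply/seteqP; split=> w /=.
  by rewrite -event_countE => /eqP; rewrite eqr_nat => /eqP.
by move=> <-; rewrite -event_countE.
Qed.

Lemma expectation_event_count (P : probability T R) :
  ('E_P[fun w => (event_count A w)%:R] = \sum_i P (A i))%E.
Proof.
rewrite unlock; under eq_integral do rewrite event_countE -sumEFin.
rewrite integral_sum//; first by apply: eq_bigr => i _; rewrite integral_indic ?setIT.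
by move=> i; exact: integrable_indic.
Qed.

End event_count_measurable.

Section event_count_config.
Context (R : realType) (d : nat) (I : finType).
Variables (B : I -> set 'rV[R]_d) (A : I -> set (config R d)).
Hypothesis sA : forall i, <<s counting_events (B i) >> (A i).

Lemma event_count_restrict (L : set 'rV[R]_d) (w : config R d) :
  (forall i, B i `<=` L) -> event_count A (config_restrict w L) = event_count A w.
Proof.
move=> BL; apply: eq_bigr => i _; congr nat_of_bool.
apply: asbool_equiv_eq.
exact: local_event_restrict w (sub_local_event (BL i) (@sA i)).
Qed.

Lemma mem_event_add (w : config R d) x i : ~ B i x ->
  (config_add w x \in A i) = (w \in A i).
Proof. by move=> Bx; apply: asbool_equiv_eq; exact: local_event_add (@sA i) Bx. Qed.

Lemma event_count_add_out (w : config R d) x : (forall i, ~ B i x) ->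
  event_count A (config_add w x) = event_count A w.
Proof. by move=> Bx; apply: eq_bigr => i _; rewrite mem_event_add. Qed.

(** Only the event attached to the region that contains [x], if there is one,
    can change its truth value. *)
Lemma event_count_add (w : config R d) x :
  (forall i j, B i x -> B j x -> i = j) ->
  `|(event_count A (config_add w x))%:R - (event_count A w)%:R| <= 1 :> R.
Proof.
move=> disjB; have [[i Bi]|nB] := pselect (exists i, B i x); last first.
  rewrite event_count_add_out ?subrr ?normr0//.
  by move=> i Bi; apply: nB; exists i.
rewrite /event_count (bigD1 i)//= [in X in _ - X](bigD1 i)//=.
rewrite (eq_bigr (fun j => nat_of_bool (w \in A j))); last first.
  move=> j ji; rewrite mem_event_add// => Bj.
  by move: ji; rewrite (disjB _ _ Bi Bj) eqxx.
rewrite !natrD opprD addrACA subrr addr0.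
by case: (_ \in _); case: (_ \in _); rewrite /= ?subrr ?subr0 ?sub0r ?normrN ?normr0 ?normr1.
Qed.

End event_count_config.

(** With [u := l * D_x G] the middle term is, up to the factor [expR (l * G)],
    the product of the gradients of [expR (l * G)] and of [l * G]. *)
Lemma expRB1_mulr (R : realType) (u : R) : `|u| <= 1 ->
  0 <= (expR u - 1) * u <= expR 1 * u ^+ 2.
Proof.
rewrite ler_norml => /andP[u1 u2].
have e1 : 1 <= expR 1 :> R by rewrite -[leLHS]expR0 ler_expR.
have eu := expR_ge1Dx u.
have [u0|u0] := leP 0 u.
  apply/andP; split; first by apply: mulr_ge0 => //; lra.
  have h : expR u - 1 <= u * expR 1.
    have : 1 - u <= expR (- u) by exact: expR_ge1Dx.
    rewrite expRN => h.
    have : expR u * (1 - u) <= 1.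
      by rewrite -ler_pdivlMl ?expR_gt0// mulr1.
    have : u * expR u <= u * expR 1 by apply: ler_wpM2l => //; rewrite ler_expR.
    lra.
  by rewrite expr2 mulrA ler_wpM2r// mulrC.
have eu1 : expR u <= 1 by rewrite -[leRHS]expR0 ler_expR ltW.
apply/andP; split; first by apply: mulr_le0; lra.
by nra.
Qed.

(** * The modified logarithmic Sobolev inequality for exponentials *)

(** For nonnegative functions the integral is a supremum over simple minorants,
    hence monotone without measurability. This avoids the joint measurability of
    the gradient in the point and the configuration. *)
Lemma ge0_le_integral_nonmeasurable (dd : measure_display) (T : measurableType dd)
    (R : realType) (m : {measure set T -> \bar R}) (f g : T -> \bar R) :
  (forall x, 0 <= f x)%E -> (forall x, f x <= g x)%E ->
  (\int[m]_x f x <= \int[m]_x g x)%E.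
Proof.
move=> f0 fg; rewrite !ge0_integralTE//; last by move=> x; exact: le_trans (fg x).
apply: ereal_sup_le => _ [h /= hf <-].
by exists h => //= x; exact: le_trans (fg x).
Qed.

(** The gradients of [expR (l * G)] and [l * G] vanish when the point lies
    outside [L], and their product is at most [expR 1 * l ^ 2 * expR (l * G)]
    otherwise, so the integral over the point costs a factor [V]. *)
Lemma MLSI1_exp_bound (R : realType) (d : nat)
    (nu : probability (config_space R d) R) (c V : R) (L : set 'rV[R]_d)
    (G : config_space R d -> nat) (N : nat) (l : R) :
  0 <= c -> MLSI1 nu c ->
  measurable L -> bounded_set L -> lebesgue_rV L = V%:E ->
  (forall j, measurable [set w | G w = j]) -> (forall w, (G w <= N)%N) ->
  (forall w, G (config_restrict w L) = G w) ->
  (forall w x, ~ L x -> G (config_add w x) = G w) ->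
  (forall w x, `|(G (config_add w x))%:R - (G w)%:R| <= 1 :> R) ->
  0 < l -> l <= 1 ->
  (Ent nu (fun w => expR (l * (G w)%:R)) <=
   (c * expR 1 * V * l ^+ 2)%:E * 'E_nu[fun w => expR (l * (G w)%:R)])%E.
Proof.
move=> c0 mlsi mL bL LV mG GN Gloc Gout G1 l0 l1.
pose F w := expR (l * (G w)%:R).
have V0 : 0 <= V by rewrite -lee_fin -LV.
have mF : measurable_fun setT F.
  apply: measurableT_comp => //; apply: measurable_funM => //.
  move=> _ Y mY; rewrite setTI.
  rewrite (_ : _ @^-1` _ = \bigcup_(j in [set j : nat | Y j%:R]) [set w | G w = j]).
    by apply: bigcup_measurable.
  apply/seteqP; split=> [w Yw|w [j Yj Gj]]; first by exists (G w).
  by rewrite /= Gj.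
have locF : local_function F by exists L; split=> // w; rewrite /F Gloc.
have bF : bounded_fun F.
  exists (expR (l * N%:R)); split; first exact: num_real.
  move=> M NM w _; rewrite /= ger0_norm ?expR_ge0//; apply: le_trans (ltW NM).
  by rewrite ler_expR ler_pM2l// ler_nat.
apply: le_trans (mlsi F mF locF bF (fun w => expR_gt0 _)) _.
have -> : (c * expR 1 * V * l ^+ 2)%:E = (c%:E * (expR 1 * V * l ^+ 2)%:E)%E.
  by rewrite -EFinM; congr EFin; ring.
rewrite -muleA; apply: lee_wpmul2l; first by rewrite lee_fin.
have grad_bound w x :
    0 <= gradient F x w * gradient (fun w' => ln (F w')) x w <=
    expR 1 * l ^+ 2 * F w * \1_L x.
  rewrite /gradient /F !expRK -mulrBr.
  set g' := (G (config_add w x))%:R; set g := (G w)%:R.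
  have g1 : `|g' - g| <= 1 by exact: G1.
  have -> : expR (l * g') - expR (l * g) = (expR (l * (g' - g)) - 1) * expR (l * g).
    by rewrite mulrBl mul1r -expRD; congr (expR _ - _); ring.
  rewrite mulrAC.
  rewrite indicE; have [xL|xL] := boolP (x \in L); last first.
    rewrite mulr0 /g' Gout; last by move/mem_set; exact/negP.
    by rewrite subrr !mulr0 mul0r lexx.
  rewrite mulr1.
  have /expRB1_mulr/andP[u0 u1] : `|l * (g' - g)| <= 1.
    by rewrite normrM (gtr0_norm l0) mulr_ile1// ltW.
  rewrite mulr_ge0 ?expR_ge0//= ler_wpM2r ?expR_ge0//.
  apply: le_trans u1 _; rewrite ler_wpM2l ?expR_ge0// exprMn ler_piMr ?sqr_ge0//.
  by rewrite -real_normK ?num_real// expr_le1.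
have -> : ((expR 1 * V * l ^+ 2)%:E * 'E_nu[F] =
    \int[nu]_w ((expR 1 * V * l ^+ 2)%:E * (F w)%:E))%E.
  rewrite ge0_integralZl//; first by rewrite unlock.
  - exact/measurable_EFinP.
  - by move=> w _; rewrite lee_fin expR_ge0.
  by rewrite lee_fin; apply: mulr_ge0; [rewrite mulr_ge0 ?expR_ge0 | exact: sqr_ge0].
apply: ge0_le_integral_nonmeasurable => w.
  by apply: integral_ge0 => x _; rewrite lee_fin; case/andP: (grad_bound w x).
have -> : ((expR 1 * V * l ^+ 2)%:E * (F w)%:E =
    \int[@lebesgue_rV R d]_x (cst (expR 1 * l ^+ 2 * F w)%:E \_ L) x)%E.
  rewrite -integral_mkcond integral_cst// [X in (_ = _ * X)%E]LV -!EFinM; congr EFin; ring.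
apply: ge0_le_integral_nonmeasurable => x.
  by rewrite lee_fin; case/andP: (grad_bound w x).
have /andP[_] := grad_bound w x; rewrite patchE indicE.
by case: (x \in L); rewrite ?mulr1 ?mulr0 lee_fin.
Qed.

(** * Boxes *)

Section boxes.
Context (R : realType) (d : nat).

Let side n : set (measurableTypeR R) := `[- n%:R, n%:R]%classic.

Let measurable_side n : measurable (side n).
Proof. exact: measurable_itv. Qed.

Let boxE n : @centered_box R d n = [set x | forall i, side n (x ord0 i)].
Proof. by apply/seteqP; split=> x h i; have := h i; rewrite /side /= in_itv. Qed.

Lemma measurable_centered_box n : measurable (@centered_box R d n).
Proof.
rewrite (_ : centered_box _ = \bigcap_(i in [set: 'I_d])
    (fun x : 'rV[R]_d => x ord0 i) @^-1` side n).
  apply: fin_bigcap_measurable => // i _; rewrite -[X in measurable X]setTI.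
  exact: (@measurable_coord R d i measurableT _ (measurable_side n)).
by rewrite boxE; apply/seteqP; split=> [x h i _|x h i]; exact: h.
Qed.

Lemma lebesgue_centered_box n :
  lebesgue_rV (@centered_box R d n) = ((2 * n%:R) ^+ d : R)%:E.
Proof.
rewrite boxE (@lebesgue_rV_box R d (fun=> side n))//.
have -> : (2 * n%:R) ^+ d = \prod_(i < d) (2 * n%:R) :> R.
  by rewrite prodr_const card_ord.
rewrite -prodEFin; apply: eq_bigr => i _.
rewrite /side lebesgue_measure_itv/= lte_fin.
have := ler0n R n; case: ifPn => [_ _|].
  by rewrite -EFinB; congr EFin; ring.
by rewrite -leNgt => n0 n0'; congr EFin; lra.
Qed.

Lemma centered_box_norm n (x : 'rV[R]_d) : centered_box n x <-> `|x| <= n%:R.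
Proof.
have -> : `|x| = \big[Num.max/0]_ij `|x ij.1 ij.2| by exact: mx_normrE.
split=> [h|/bigmax_leP[_ h] i].
  apply/bigmax_leP; split=> // -[i j] _ /=; rewrite (ord1 i) ler_norml; exact: h.
by have := h (ord0, i) isT; rewrite /= ler_norml.
Qed.

Lemma bounded_centered_box n : bounded_set (@centered_box R d n).
Proof.
exists n%:R; split; first exact: num_real.
by move=> M nM x /centered_box_norm; move/le_trans; apply; exact: ltW.
Qed.

Lemma bounded_sub_centered_box (D : set 'rV[R]_d) : bounded_set D ->
  exists n, D `<=` centered_box n.
Proof.
move=> [M [_ MD]]; exists (Num.truncn (Num.max (M + 1) 0)).+1 => x Dx.
apply/centered_box_norm.
apply: (@le_trans _ _ (Num.max (M + 1) 0)).
  by apply: (MD _ _ x Dx); rewrite lt_max ltrDl ltr01.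
by apply: ltW; apply: truncnS_gt.
Qed.

Lemma sub_centered_box n m : (n <= m)%N -> @centered_box R d n `<=` centered_box m.
Proof.
move=> nm x /centered_box_norm xn; apply/centered_box_norm.
by apply: le_trans xn _; rewrite ler_nat.
Qed.

End boxes.

(** If [mu B <= nu B] for every event [B] of every box, then taking complements
    gives equality on all of these events, which are stable under intersection
    because the boxes increase. The complement also fixes the sign of the
    difference. *)
Lemma separating_local_event (R : realType) (d : nat)
    (mu nu : probability (config_space R d) R) :
  ~ same_measure mu nu ->
  exists m A, <<s counting_events (@centered_box R d m) >> A /\ (nu A < mu A)%E.
Proof.
move=> neq; apply: contrapT => nex; apply: neq => A mA.
have mev m B : <<s counting_events (@centered_box R d m) >> B ->
    measurable (B : set (config_space R d)).
  exact: sub_local_event.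
pose E := [set B : set (config_space R d) | exists m,
  <<s counting_events (@centered_box R d m) >> B].
have le_E B : E B -> (mu B <= nu B)%E.
  by move=> [m sB]; rewrite leNgt; apply/negP => lt; apply: nex; exists m, B.
have EC B : E B -> E (~` B).
  by move=> [m sB]; exists m; exact: sigma_algebraC.
apply: (measure_unique E (fun=> setT)) => //.
- apply/seteqP; split.
    apply: sub_smallest2r; first exact: smallest_sigma_algebra.
    move=> _ [D [k [mD bD _ ->]]].
    have [m Dm] := bounded_sub_centered_box bD.
    by exists m; apply: sub_sigma_algebra; exists D, k.
  apply: smallest_sub; first exact: smallest_sigma_algebra.
  by move=> B [m sB]; exact: mev sB.
- move=> B C [m sB] [n sC]; exists (maxn m n).
  apply: (@measurableI _ (local_config_space (centered_box (maxn m n)))).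
  + by apply: sub_local_event sB; apply: sub_centered_box; exact: leq_maxl.
  + by apply: sub_local_event sC; apply: sub_centered_box; exact: leq_maxr.
- move=> _; exists 0%N; exact: (@measurableT _ (local_config_space (centered_box 0))).
- by rewrite bigcup_const//; exists 0%N.
- move=> B EB; apply/eqP; rewrite eq_le le_E//=.
  have mB : measurable B by case: EB => m; exact: mev.
  have := le_E _ (EC _ EB); rewrite !probability_setC//.
  by rewrite leeD2lE// leeN2.
- by move=> _; apply: le_lt_trans (probability_le1 mu measurableT) _; exact: ltry.
Qed.

(** * Packing and the lower bound *)

(** Each term gains the difference of the probabilities of an event, while all
    events together cost only the volume of [L], because the regions on which
    they depend are disjoint. *)
Lemma relative_entropy_packing (R : realType) (d : nat)
    (mu nu : probability (config_space R d) R) (c V t : R) (L : set 'rV[R]_d)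
    (I : finType) (B : I -> set 'rV[R]_d) (A : I -> set (config R d)) :
  0 <= c -> MLSI1 nu c ->
  measurable L -> bounded_set L -> lebesgue_rV L = V%:E ->
  (forall i, <<s counting_events (B i) >> (A i)) ->
  (forall i, B i `<=` L) ->
  (forall x i j, B i x -> B j x -> i = j) ->
  0 < t -> t <= 1 ->
  ((t * \sum_i (fine (mu (A i)) - fine (nu (A i))) -
      c * expR 1 * V * t ^+ 2)%:E <=
   relative_entropy (restrict_measure mu L) (restrict_measure nu L))%E.
Proof.
move=> c0 mlsi mL bL LV sA BL disjB t0 t1.
pose G (w : config R d) := event_count A w.
have sAL i : <<s counting_events L >> (A i) by exact: sub_local_event (sA i).
have mGL j : measurable ([set w | G w = j] : set (local_config_space L)).
  exact: (@measurable_event_count _ (local_config_space L) R).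
have mG j : measurable ([set w | G w = j] : set (config_space R d)).
  apply: (@measurable_event_count _ (config_space R d) R) => i.
  exact: sub_local_event (sA i).
have GN w : (G w <= #|I|)%N by exact: event_count_le.
apply: le_trans (Donsker_Varadhan (restrict_measure mu L) (restrict_measure nu L) t mGL GN).
have restrictE (phi : nat -> R) (rho : probability (config_space R d) R) :
    ('E_(restrict_measure rho L)[fun w => phi (G w)] =
     'E_rho[fun w => phi (G w)])%E.
  rewrite (expectation_nat_valued (restrict_measure rho L) mGL GN phi).
  by rewrite (expectation_nat_valued rho mG GN phi).
have mA i : measurable (A i : set (config_space R d)).
  exact: sub_local_event (sA i).
have EG (rho : probability (config_space R d) R) :
    fine ('E_rho[fun w => (G w)%:R])%E = \sum_i fine (rho (A i)).
  rewrite (expectation_event_count mA rho).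
  rewrite (eq_bigr (fun i => (fine (rho (A i)))%:E)); first by rewrite sumEFin.
  by move=> i _; rewrite fineK// fin_num_measure.
have entG (l : R) : 0 < l -> l < t ->
    (Ent nu (fun w => expR (l * (G w)%:R)) <= (c * expR 1 * V * l ^+ 2)%:E *
      'E_nu[fun w => expR (l * (G w)%:R)])%E.
  move=> l0 lt; apply: (MLSI1_exp_bound c0 mlsi mL bL LV mG GN) => //.
  - by move=> w; exact: (event_count_restrict sA).
  - by move=> w x Lx; apply: (event_count_add_out sA) => i /BL.
  - by move=> w x; apply: (event_count_add sA); exact: disjB.
  - exact: le_trans (ltW lt) t1.
have := Herbst_nat_valued mG GN t0 entG.
rewrite (restrictE (fun j => j%:R)) (restrictE (fun j => expR (t * j%:R))).
rewrite !EG lee_fin sumrB mulrBr; lra.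
Qed.

Section lattice.
Context (R : realType) (d K m : nat).
Implicit Types (k : {ffun 'I_d -> 'I_K.+1}) (x : 'rV[R]_d).

(** The spacing [2 * m + 1] exceeds the side [2 * m] of the boxes, which makes
    the translated closed boxes disjoint. *)
Definition lattice_point k : 'rV[R]_d := \row_i (m.*2.+1 * k i)%:R.

Lemma lattice_boxes_disjoint x k k' :
  centered_box m (x - lattice_point k) -> centered_box m (x - lattice_point k') ->
  k = k'.
Proof.
move=> xk xk'; apply/ffunP => i; apply: val_inj => /=.
have le_coord (j j' : 'I_K.+1) :
    - m%:R <= x ord0 i - (m.*2.+1 * j)%:R <= m%:R ->
    - m%:R <= x ord0 i - (m.*2.+1 * j')%:R <= m%:R -> (j <= j')%N.
  move=> /andP[h1 _] /andP[_ h2].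
  have : (m.*2.+1 * j)%:R <= (m.*2.+1 * j' + m.*2)%:R :> R.
    have m2 : (m.*2)%:R = m%:R + m%:R :> R by rewrite -addnn natrD.
    rewrite natrD m2; lra.
  rewrite ler_nat => le_jj'; rewrite leqNgt; apply/negP => lt_j'j.
  have := leq_trans (leq_mul (leqnn m.*2.+1) lt_j'j) le_jj'.
  by rewrite mulnS addnC leq_add2l ltnn.
have := xk i; have := xk' i; rewrite !mxE => h' h.
by apply/eqP; rewrite eqn_leq !le_coord.
Qed.

Lemma lattice_box_sub n k x : (m.*2.+1 * K + m <= n)%N ->
  centered_box m (x - lattice_point k) -> centered_box n x.
Proof.
move=> Kn xk i; have := xk i; rewrite !mxE.
have kK : (m.*2.+1 * k i + m <= n)%N.
  by apply: leq_trans Kn; rewrite leq_add2r leq_mul2l -ltnS ltn_ord orbT.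
have : (m.*2.+1 * k i)%:R + m%:R <= n%:R :> R by rewrite -natrD ler_nat.
have : 0 <= (m.*2.+1 * k i)%:R :> R by [].
move=> h0 h1 /andP[h2 h3]; apply/andP; split; lra.
Qed.

End lattice.

Lemma limn_einf_ge (R : realType) (u : (\bar R)^nat) (a : \bar R) (n0 : nat) :
  (forall n, (n0 <= n)%N -> (a <= u n)%E) -> (a <= limn_einf u)%E.
Proof.
move=> au; rewrite limn_einf_lim; apply: lime_ge; first exact: is_cvg_einfs.
near=> n; apply: le_ereal_inf_tmp => _ [k /= nk <-]; apply: au.
by apply: leq_trans nk; near: n; exists n0.
Unshelve. all: by end_near. Qed.

Unset Implicit Arguments.
Theorem theorem1p4 (R : realType) (d : nat) (d_gt0 : (0 < d)%N)
    (nu : probability (config_space R d) R) (c : R) :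
  translation_invariant nu ->
  0 < c ->
  MLSI1 nu c ->
  forall mu : probability (config_space R d) R,
    translation_invariant mu ->
    ~ same_measure mu nu ->
    (0 < specific_relative_entropy mu nu)%E.
Proof.
move=> inv_nu c0 mlsi mu inv_mu /separating_local_event[m [A [sA nuA_lt_muA]]].
have mA : measurable (A : set (config_space R d)) by exact: sub_local_event sA.
pose delta := fine (mu A) - fine (nu A).
have delta0 : 0 < delta.
  by rewrite subr_gt0 fine_lt// fin_num_measure.
pose s := m.*2.+1.
(* Along an axis of length [2 * n] there are at least [n / (2 * s)] boxes, so
   that [kappa] bounds from below the number of boxes per unit of volume. *)
pose kappa : R := (4 * s%:R) ^- d.
have kappa0 : 0 < kappa by rewrite invr_gt0 exprn_gt0// mulr_gt0.
pose C := c * expR 1.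
have C0 : 0 < C by rewrite mulr_gt0// expR_gt0.
(* The cap 1 keeps the exponential factor of the entropy estimate bounded by
   [expR 1]; the other bound makes the quadratic cost at most half of the linear
   gain. *)
pose t := Num.min 1 (kappa * delta / (2 * C)).
have t0 : 0 < t by rewrite lt_min ltr01 divr_gt0// mulr_gt0.
have t1 : t <= 1 by rewrite ge_min lexx.
have Ct : C * t <= kappa * delta / 2.
  rewrite mulrC -ler_pdivlMr//; apply: (@le_trans _ _ (kappa * delta / (2 * C))).
    by rewrite ge_min lexx orbT.
  by rewrite invfM mulrA.
apply: (@lt_le_trans _ _ (t * kappa * delta / 2)%:E).
  by rewrite lte_fin !mulr_gt0.
(* From [n > 2 * m] on, the loss of [m] at the boundary is at most half of
   [n]. *)
apply: (@limn_einf_ge _ _ _ m.*2.+1) => n mn.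
pose K := ((n - m) %/ s)%N.
pose V : R := (2 * n%:R) ^+ d.
have V0 : 0 < V by rewrite exprn_gt0// mulr_gt0// ltr0n; lia.
rewrite /relative_entropy_density lebesgue_centered_box /=.
rewrite muleC -lee_pdivrMr ?invr_gt0// -EFinM.
have B_sub (k : {ffun 'I_d -> 'I_K.+1}) :
    [set y : 'rV[R]_d | centered_box m (y - lattice_point R m k)] `<=`
    centered_box n.
  move=> y; apply: lattice_box_sub.
  have := leq_trunc_div (n - m) s; rewrite -/K -/s mulnC; lia.
have H := relative_entropy_packing mu (ltW c0) mlsi (@measurable_centered_box R d n)
  (@bounded_centered_box R d n) (@lebesgue_centered_box R d n)
  (A := fun k : {ffun 'I_d -> 'I_K.+1} => translate (lattice_point R m k) @^-1` A)
  (fun k => local_event_translate (fun y => id) sA) B_sub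
  (fun x k k' => @lattice_boxes_disjoint R d K m x k k') t0 t1.
apply: (le_trans _ H) => {H}.
rewrite lee_fin.
have -> : \sum_(k : {ffun 'I_d -> 'I_K.+1})
    (fine (mu (translate (lattice_point R m k) @^-1` A)) -
     fine (nu (translate (lattice_point R m k) @^-1` A))) = K.+1%:R ^+ d * delta.
  rewrite (eq_bigr (fun=> delta)); last first.
    move=> k _; rewrite /delta -(inv_mu (lattice_point R m k) A)//.
    by rewrite -(inv_nu (lattice_point R m k) A).
  by rewrite sumr_const card_ffun !card_ord -[LHS]mulr_natl natrX.
have VK : kappa * V <= K.+1%:R ^+ d.
  have s0 : 0 < 4 * s%:R :> R by rewrite mulr_gt0.
  rewrite mulrC ler_pdivrMr ?exprn_gt0// -exprMn.
  apply: lerXn2r; rewrite ?nnegrE ?mulr_ge0//.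
  rewrite -!natrM ler_nat.
  have := ltn_ceil (n - m) (ltn0Sn m.*2 : 0 < s)%N; rewrite -/K; lia.
(* The gain, then the cost, compared with the volume [V]. *)
have h1 : t * (kappa * V) * delta <= t * K.+1%:R ^+ d * delta.
  by rewrite ler_wpM2r ?(ltW delta0)// ler_wpM2l// ltW.
have h2 : V * t * (C * t) <= V * t * (kappa * delta / 2).
  by rewrite ler_wpM2l// mulr_ge0 ?ltW.
rewrite invrK -/V -/C expr2; lra.
Qed.
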